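(* Let $E\subset\mathbb{R}^2$ be a boundary element with nodal basis vector $\boldsymbol{\phi}(\boldsymbol{x})\in\mathbb{R}^{N}$ and mass matrix $M$, let $\tilde{\boldsymbol{x}}$ be a point of the surrogate boundary on $E$, let $\bar{\boldsymbol{x}}$ be the corresponding point of the true boundary, let $\boldsymbol{u}\in\mathbb{R}^{N}$ be the coefficient vector of the internal polynomial $u_h(\boldsymbol{x})=\boldsymbol{\phi}^T(\boldsymbol{x})\boldsymbol{u}$, and let $u_D\in\mathbb{R}$ be the Dirichlet value prescribed at $\bar{\boldsymbol{x}}$. Let $(\boldsymbol{v},\lambda)\in\mathbb{R}^{N}\times\mathbb{R}$ be the solution, obtained by inversion, of the linear system $$\begin{bmatrix} M & \boldsymbol{\phi}(\bar{\boldsymbol{x}}) \\ \boldsymbol{\phi}^T(\bar{\boldsymbol{x}}) & 0 \end{bmatrix} \begin{bmatrix}\boldsymbol{v} \\ \lambda \end{bmatrix} = \begin{bmatrix} M \boldsymbol{u} \\ u_D \end{bmatrix},$$ and let $\tilde u_D:=\boldsymbol{\phi}(\tilde{\boldsymbol{x}})^T\boldsymbol{v}$ be the ROD-$L^2$ modified Dirichlet boundary condition at $\tilde{\boldsymbol{x}}$. Then $$\tilde u_D = [\boldsymbol{\phi}(\tilde{\boldsymbol{x}}) - \alpha\, \boldsymbol{\phi}(\bar{\boldsymbol{x}})]^T \boldsymbol{u} + \alpha\, u_D,\qquad \alpha = \frac{\boldsymbol{\phi}(\tilde{\boldsymbol{x}})^T M^{-1} \boldsymbol{\phi}(\bar{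\boldsymbol{x}})}{\|\boldsymbol{\phi}(\bar{\boldsymbol{x}})\|^2_{M^{-1}}}.$$
   Context: The boundary element $E$ is an affine image of the reference square $[-1,1]^2$. For a polynomial degree $p\ge 1$ and $N=(p+1)^2$, $\boldsymbol{\phi}=[\phi_1,\ldots,\phi_N]^T$ is the vector of nodal (Lagrange) basis polynomials on $E$, namely the tensor-product Lagrange polynomials of degree $p$ in each variable associated with the tensor-product Gauss-Lobatto-Legendre points. They form a basis of the local polynomial space. As polynomials they are also evaluated at points outside $E$, so $\boldsymbol{\phi}(\bar{\boldsymbol{x}})$ makes sense even when $\bar{\boldsymbol{x}}\notin E$. The mass matrix is $M_{ij}=\int_E \phi_i\phi_j\,d\boldsymbol{x}$, which is symmetric positive definite. For $\boldsymbol{a}\in\mathbb{R}^N$, $\|\boldsymbol{a}\|_{M^{-1}}^2:=\boldsymbol{a}^TM^{-1}\boldsymbol{a}$. The surrogate boundary is the boundary of the unfitted computational mesh to which $E$ belongs; each of its points $\tilde{\boldsymbol{x}}$ is mapped to a point $\bar{\boldsymbol{x}}$ of the true boundary of the physical domain, where the boundary condition is prescribed. The linear system consists of the optimality conditions of the functional $\mathcal{L}(\boldsymbol{v},\lambda)=\frac12\|\boldsymbol{\phi}^T\boldsymbol{v}-u_h\|_{L^2(E)}^2+\lambda(\boldsymbol{\phi}(\bar{\boldsymbol{x}})^T\boldsymbol{v}-u_D)$. *)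

(* Defs.v *)
From HB Require Import structures.
From mathcomp Require Import all_boot all_order all_algebra.
From mathcomp Require Import polyrcf.
From mathcomp Require Import all_classical all_reals all_analysis.
Set Implicit Arguments.
Unset Strict Implicit.
Unset Printing Implicit Defensive.
Import Order.TTheory GRing.Theory Num.Theory.
Import numFieldNormedType.Exports.

Local Open Scope classical_set_scope.
Local Open Scope ring_scope.

Section Algebra.
Context {R : realType}.

Definition dotv (n : nat) (a b : 'cV[R]_n) : R := (a^T *m b) 0 0.

Definition sqnorm_inv (n : nat) (M : 'M[R]_n) (a : 'cV[R]_n) : R :=
  (a^T *m invmx M *m a) 0 0.

End Algebra.

Section Nodes.
Variable R : realType.

(* Rodrigues' formula *)
Definition legendre (p : nat) : {poly R} :=
  ((2 ^ p * p`!)%N%:R)^-1 *: (('X^2 - 1) ^+ p)^`(p).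

(* The p + 1 Gauss-Lobatto-Legendre points are the zeros of
   (1 - x^2) P_p'(x), i.e. the end points of [-1, 1] and the zeros of P_p';
   rootsR lists them in increasing order. *)
Definition gll_node (p i : nat) : R :=
  (rootsR ((1 - 'X^2) * (legendre p)^`()))`_i.

Definition gll_lagrange (p : nat) (i : 'I_p.+1) : {poly R} :=
  tnth (lagrange p.+1 (gll_node p)) i.

End Nodes.

Section Element.
Context {R : realType}.

Definition ref_square : set (R * R) := `[-1, 1] `*` `[-1, 1].

(* An element is given by an invertible affine map xi |-> b + A xi, so that
   the ordering of its nodes is fixed and its area is nonzero. *)
Record element := Element {
  elt_lin : 'M[R]_2;
  elt_orig : R * R;
  elt_lin_unit : elt_lin \in unitmx }.

Definition mul_pt (A : 'M[R]_2) (x : R * R) : R * R :=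
  (A 0 0 * x.1 + A 0 1 * x.2, A 1 0 * x.1 + A 1 1 * x.2).

Definition elt_map (E : element) (xi : R * R) : R * R :=
  elt_orig E + mul_pt (elt_lin E) xi.

Definition elt_invmap (E : element) (x : R * R) : R * R :=
  mul_pt (invmx (elt_lin E)) (x - elt_orig E).

Definition elt_set (E : element) : set (R * R) := elt_map E @` ref_square.

(* Entry mxvec_index i j is the product of the i-th and j-th Lagrange
   polynomials in the two reference coordinates; it is defined on the whole
   plane, not only on the element. *)
Definition nodal_basis (p : nat) (E : element) (x : R * R)
    : 'cV[R]_(p.+1 * p.+1) :=
  (mxvec (\matrix_(i < p.+1, j < p.+1)
     ((gll_lagrange R i).[(elt_invmap E x).1] *
      (gll_lagrange R j).[(elt_invmap E x).2])))^T.

Definition mass_matrix (p : nat) (E : element) : 'M[R]_(p.+1 * p.+1) :=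
  \matrix_(i, j)
    \int[(lebesgue_measure \x lebesgue_measure)%E]_(x in elt_set E)
      (nodal_basis p E x i 0 * nodal_basis p E x j 0).

End Element.

Arguments element : clear implicits.

Section Mesh.
Context {R : realType}.

Definition topo_boundary (A : set (R * R)) : set (R * R) :=
  closure A `\` interior A.

Definition is_mesh (T : set (element R)) : Prop :=
  finite_set T /\ trivIset T (fun E => interior (elt_set E)).

Definition surrogate_boundary (T : set (element R)) : set (R * R) :=
  topo_boundary (\bigcup_(E in T) elt_set E).

End Mesh.

Section System.
Context {R : realType}.

Definition rod_matrix (p : nat) (E : element R) (xb : R * R)
    : 'M[R]_(p.+1 * p.+1 + 1) :=
  block_mx (mass_matrix p E) (nodal_basis p E xb)
           (nodal_basis p E xb)^T 0.

Definition rod_rhs (p : nat) (E : element R) (u : 'cV[R]_(p.+1 * p.+1))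
    (uD : R) : 'cV[R]_(p.+1 * p.+1 + 1) :=
  col_mx (mass_matrix p E *m u) uD%:M.

Definition rod_alpha (p : nat) (E : element R) (xt xb : R * R) : R :=
  dotv (nodal_basis p E xt) (invmx (mass_matrix p E) *m nodal_basis p E xb)
  / sqnorm_inv (mass_matrix p E) (nodal_basis p E xb).

End System.

(* Main.v *)
Require Import Defs.
From mathcomp Require Import all_boot all_order all_algebra.
From mathcomp Require Import polyrcf polyorder.
From mathcomp Require Import all_classical all_reals all_analysis measurable_realfun.
From mathcomp Require Import ring lra.

(** Eliminating the unknowns of the saddle-point system gives the formula.
    With phi the basis vector at the true boundary point and
    s = phi^T M^-1 phi, the first block row reads v = u - lam M^-1 phi; the
    constraint phi^T v = uD then forces lam = (phi^T u - uD) / s, and pairing v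
    with the basis vector at the surrogate point produces the weight alpha
    ([saddle_point_dotv]).  This needs M invertible and s nonzero, and the
    system is solvable by inversion when moreover phi is nonzero.  All of it
    follows from two facts: M is positive definite and phi never vanishes.

    The basis vector never vanishes, at any point of the plane, because the
    nodal polynomials add up to 1 ([nodal_basis_neq0]).

    The mass matrix is a Gram matrix, so c^T M c is the integral over the
    element of the square of g = sum_k c_k phi_k.  If it vanishes, g is zero
    almost everywhere on the element; being continuous, g is zero on the
    interior, since a nonempty open set is not negligible.  In reference
    coordinates g is a tensor-product polynomial that vanishes on the open
    square, hence everywhere, and its values at the nodes are the coefficients
    c_k ([nodal_basis_free]).

    This last step, like the identity sum_i L_i = 1, requires the p + 1
    Gauss-Lobatto-Legendre points to be distinct, that is, (1 - X^2) P_p' to have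
    p + 1 distinct real roots.  They are obtained by applying Rolle's theorem
    repeatedly to (X^2 - 1)^p: as long as fewer than p derivatives have been
    taken, -1 and 1 remain roots, so that each differentiation gains one root in
    the open interval ([derivn_sqrX_sub1_roots]). *)

Set Implicit Arguments.
Unset Strict Implicit.
Unset Printing Implicit Defensive.
Import Order.TTheory GRing.Theory Num.Theory.
Import numFieldNormedType.Exports.
Local Open Scope classical_set_scope.
Local Open Scope ring_scope.

(** * Saddle-point systems *)

Section SaddlePoint.
Context {R : realType} {n : nat}.
Implicit Types (M : 'M[R]_n) (a b c u v : 'cV[R]_n).

Definition positive_definite M :=
  forall c, c != 0 -> 0 < (c^T *m M *m c) 0 0.

Lemma positive_definite_unit M : positive_definite M -> M \in unitmx.
Proof.
move=> M_pd; rewrite -row_free_unit; apply: inj_row_free => v vM.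
apply: contraTeq isT => v0; have /M_pd : v^T != 0 by rewrite trmx_eq0.
by rewrite trmxK vM mul0mx mxE ltxx.
Qed.

(** With a = M c, the quadratic form of M^-1 at a is that of M at c. *)
Lemma sqnorm_inv_gt0 M a : positive_definite M -> a != 0 -> 0 < sqnorm_inv M a.
Proof.
move=> M_pd a0; have M_unit := positive_definite_unit M_pd.
have /M_pd : invmx M *m a != 0.
  by apply: contraNneq a0 => Ma0; rewrite -[a](mulKVmx M_unit) Ma0 mulmx0.
have -> : (invmx M *m a)^T *m M *m (invmx M *m a) = (a^T *m invmx M *m a)^T.
  by rewrite -mulmxA mulKVmx// !trmx_mul trmxK mulmxA.
by rewrite mxE.
Qed.

(** Pairing the first block row of a kernel vector (w, l) with w cancels the
    multiplier term, because w is orthogonal to b; so w = 0 by definiteness, and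
    then l b = 0. *)
Lemma saddle_point_unit M b : positive_definite M -> b != 0 ->
  block_mx M b b^T (0 : 'M[R]_1) \in unitmx.
Proof.
move=> M_pd b0; rewrite -row_free_unit; apply: inj_row_free => w.
rewrite -[w]hsubmxK; move: (lsubmx w) (rsubmx w) => {w} w l.
rewrite mul_row_block mulmx0 addr0 -[RHS]row_mx0 => /eq_row_mx[wM wb].
have w0 : w = 0.
  apply: contraTeq isT => w0; have /M_pd : w^T != 0 by rewrite trmx_eq0.
  move/(congr1 (mulmxr w^T)): wM.
  rewrite /= mulmxDl mul0mx -[l *m _ *m _]mulmxA -trmx_mul wb.
  by rewrite trmx0 mulmx0 addr0 trmxK => ->; rewrite mxE ltxx.
move: wM; rewrite w0 mul0mx add0r [l]mx11_scalar mul_scalar_mx => /eqP.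
by rewrite scaler_eq0 trmx_eq0 (negPf b0) orbF => /eqP ->; rewrite raddf0 row_mx0.
Qed.

(** Block elimination: the constraint determines the multiplier, whose
    contribution to the pairing of v with t is alpha (d - b^T u). *)
Lemma saddle_point_dotv M b t u v (lam d : R)
    (alpha := dotv t (invmx M *m b) / sqnorm_inv M b) :
    M \in unitmx -> sqnorm_inv M b != 0 ->
    block_mx M b b^T 0 *m col_mx v lam%:M = col_mx (M *m u) d%:M ->
  dotv t v = dotv (t - alpha *: b) u + alpha * d.
Proof.
move=> M_unit s0; rewrite mul_block_col mul0mx addr0 => /eq_col_mx[Mv bv].
have vE : v = u - lam *: (invmx M *m b).
  apply: (can_inj (mulKmx M_unit)); rewrite mulmxBr -scalemxAr mulKVmx// -Mv.
  by rewrite mul_mx_scalar addrK.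
have dE : d = dotv b u - lam * sqnorm_inv M b.
  move/(congr1 (fun A : 'M[R]_1 => A 0 0)): bv; rewrite [in RHS]mxE mulr1n => <-.
  by rewrite vE mulmxBr -scalemxAr mulmxA /dotv /sqnorm_inv !mxE.
have -> : dotv t v = dotv t u - lam * dotv t (invmx M *m b).
  by rewrite /dotv vE mulmxBr -scalemxAr !mxE.
have -> : dotv (t - alpha *: b) u = dotv t u - alpha * dotv b u.
  by rewrite /dotv linearB/= linearZ/= mulmxBl -scalemxAl !mxE.
by rewrite dE /alpha; field.
Qed.

End SaddlePoint.

(** * The Gauss-Lobatto-Legendre points are distinct *)

(** The bounds on t are strict, so that the roots found can again be enclosed by
    the end points of the interval in the next application. *)
Lemma rolle_interlace (R : rcfType) (f : {poly R}) (a : R) (s : seq R) :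
    path <%R a s -> all (root f) (a :: s) ->
  exists t : seq R, [/\ size t = size s, path <%R a t,
    all (< last a s) t & all (root f^`()) t].
Proof.
elim: s a => [|b s IHs] a /=; first by exists [::].
case/andP=> ltab pbs /and3P[fa fb fs].
have [|t [szt pbt tlast ft]] := IHs b pbs; first by rewrite /= fb.
have [c /[!in_itv]/= /andP[ltac ltcb] fc] : {c | c \in `]a, b[ & f^`().[c] = 0}.
  by apply: poly_rolle ltab _; rewrite (rootP fa) (rootP fb).
exists (c :: t); split => /=.
- by rewrite szt.
- by rewrite ltac; apply: (path_le lt_trans ltcb).
- rewrite tlast andbT (lt_le_trans ltcb)//.
  by move: (pbs); rewrite lt_path_sortedE => /andP[/allP bs _];
     have /predU1P[->|/bs/ltW] := mem_last b s.
- by rewrite ft andbT; exact/rootP.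
Qed.

(** Each differentiation of a product with g^m costs at most one factor g. *)
Lemma derivn_exp_factor (R : comNzRingType) (g : {poly R}) (n k : nat) :
  (k <= n)%N -> exists h, (g ^+ n)^`(k) = g ^+ (n - k) * h.
Proof.
elim: k => [|k IHk] lekn; first by exists 1; rewrite subn0 mulr1.
have [h hE] := IHk (ltnW lekn).
exists (g^`() * h *+ (n - k) + g * h^`()).
rewrite derivnS hE derivM deriv_exp -subnS mulrDr; congr (_ + _).
  by rewrite mulrnAl mulrnAr; congr (_ *+ _); ring.
by rewrite mulrA -exprSr -subSn.
Qed.

Lemma lt_path_rcons d (T : porderType d) (a b : T) (s : seq T) :
    (a < b)%O -> path <%O a s -> all (< b)%O s -> path <%O a (rcons s b).
Proof.
move=> ab pas /allP sb; rewrite rcons_path pas/=.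
by have /predU1P[->|/sb] := mem_last a s.
Qed.

(** Before the k-th differentiation, -1 and 1 enclose the k - 1 interior roots
    and are themselves roots, so Rolle's theorem yields k interior ones. *)
Lemma derivn_sqrX_sub1_roots (R : rcfType) (p k : nat) : (k <= p)%N ->
  exists s : seq R, [/\ size s = k, path <%R (-1) s, all (< 1) s
    & all (root (('X^2 - 1) ^+ p)^`(k)) s].
Proof.
elim: k => [|k IHk] ltkp; first by exists [::].
have [s [szs pas slt sroot]] := IHk (ltnW ltkp).
have end_root (x : R) : x ^+ 2 = 1 -> root (('X^2 - 1) ^+ p)^`(k) x.
  move=> x2; have [h ->] := derivn_exp_factor ('X^2 - 1 : {poly R}) (ltnW ltkp).
  by rewrite rootE !hornerE x2 subrr expr0n subn_eq0 leqNgt ltkp mul0r.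
have [||t [szt pt tlt troot]] :=
  @rolle_interlace _ (('X^2 - 1) ^+ p)^`(k) (-1) (rcons s 1).
- by apply: lt_path_rcons => //; lra.
- by rewrite /= all_rcons sroot !end_root// ?expr1n// sqrrN expr1n.
exists t; split=> //.
- by rewrite szt size_rcons szs.
- by move: tlt; rewrite last_rcons.
Qed.

Lemma gll_poly_neq0 (R : realType) (p : nat) : (0 < p)%N ->
  (1 - 'X^2) * (legendre R p)^`() != 0.
Proof.
move=> p_gt0; apply: mulf_neq0.
  by rewrite -opprB oppr_eq0 -size_poly_eq0 size_XnsubC.
rewrite /legendre derivZ scaler_eq0 invr_eq0 pnatr_eq0 muln_eq0 expn_eq0/=.
rewrite -[p`! == 0%N]negbK -lt0n fact_gt0/= -derivnS -derivn_poly0 -ltnNge.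
by rewrite -ltn_predRL size_exp size_XnsubC//= mul2n -addnn -{1}[p]addn0 ltn_add2l.
Qed.

(** One more application of Rolle's theorem to the p interior roots of P_p
    gives p - 1 roots of P_p'; the factor 1 - X^2 adds -1 and 1. *)
Lemma gll_poly_roots (R : realType) (p : nat) : (0 < p)%N ->
  exists s : seq R, [/\ size s = p.+1, sorted <%R s
    & all (root ((1 - 'X^2) * (legendre R p)^`())) s].
Proof.
move=> p_gt0.
(* The p-th derivative of (X^2 - 1)^p is P_p up to a nonzero factor. *)
have [s [szs pas slt sroot]] := @derivn_sqrX_sub1_roots R p p (leqnn p).
case: s szs pas slt sroot => [|a s] szs; first by rewrite -szs in p_gt0.
move=> /= /andP[lta pas] /andP[a1 slt] sroot.
have [t [szt pt tlt troot]] := rolle_interlace pas sroot.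
have tlt1 : all (< 1) t.
  apply/allP => x /(allP tlt) /lt_le_trans; apply.
  by have /predU1P[->|/(allP slt)/ltW//] := mem_last a s; exact: ltW.
exists (-1 :: rcons t 1); split => /=.
- by rewrite size_rcons szt -szs.
- apply: (lt_path_rcons (lt_trans lta a1)) => //.
  by apply: (path_le lt_trans lta).
- rewrite all_rcons !rootE !hornerE !sqrrN !expr1n !subrr !mul0r !eqxx/=.
  by apply/allP => x /(allP troot) rx; rewrite rootM derivZ rootZ ?rx ?orbT.
Qed.

Lemma gll_node_inj (R : realType) (p i j : nat) :
    (0 < p)%N -> (i <= p)%N -> (j <= p)%N ->
  gll_node R p i = gll_node R p j -> i = j.
Proof.
move=> p_gt0 ip jp; have [s [szs ss sroot]] := gll_poly_roots R p_gt0.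
have sz : (p < size (rootsR ((1 - 'X^2) * (legendre R p)^`())))%N.
  rewrite -szs; apply: uniq_leq_size; first exact: lt_sorted_uniq.
  move=> x /(allP sroot) rx.
  by rewrite -roots_on_rootsR ?gll_poly_neq0// in_itv.
move=> /eqP; rewrite /gll_node nth_uniq ?(leq_ltn_trans _ sz)//.
  by move/eqP.
by rewrite uniq_roots.
Qed.

(** * Lagrange polynomials at the Gauss-Lobatto-Legendre points *)

Lemma eq_lagrange (K : fieldType) (n : nat) (x y : nat -> K) :
  (forall i, (i < n)%N -> x i = y i) -> n.-lagrange x = n.-lagrange y.
Proof.
(* The constant is locked by an opaque key; a case on the key unlocks it. *)
move=> xy; rewrite /lagrange; case: qpoly.lagrange_key => /=.
apply: eq_from_tnth => i; rewrite !tnth_map tnth_ord_tuple xy//.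
by under eq_bigr => j _ do rewrite xy//.
Qed.

(** The theory of [lagrange] assumes nodes that are injective on all of nat,
    whereas [gll_node] is constantly 0 past its last node.  Only the first n
    values matter by [eq_lagrange], so the tail can be replaced. *)
Lemma injective_extension (K : realFieldType) (n : nat) (x : nat -> K) :
    (forall i j, (i < n)%N -> (j < n)%N -> x i = x j -> i = j) ->
  exists2 y : nat -> K, injective y & forall i, (i < n)%N -> x i = y i.
Proof.
(* M exceeds all the first n values, so M + i cannot meet them. *)
move=> x_inj; pose M := \sum_(i < n) `|x i| + 1.
have xM i : (i < n)%N -> x i < M.
  move=> ltin; rewrite /M (bigD1 (Ordinal ltin))//= ltr_pwDr//.
  by rewrite (le_trans (ler_norm _))// lerDl sumr_ge0.
exists (fun i => if (i < n)%N then x i else M + i%:R); last by move=> i ->.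
have M_neq i j : (i < n)%N -> x i <> M + j%:R.
  by move=> /xM lt xE; move: lt; rewrite xE ltNge lerDl ler0n.
move=> i j; case: ifPn => [ltin|_]; case: ifPn => [ltjn|_].
- exact: x_inj.
- by move/(M_neq _ _ ltin).
- by move/esym/(M_neq _ _ ltjn).
- by move/addrI/eqP; rewrite eqr_nat => /eqP.
Qed.

Section GLLLagrange.
Context {R : realType} (p : nat) (p_gt0 : (0 < p)%N).
Local Notation L := (@gll_lagrange R p).

Let injective_nodes : exists2 y : nat -> R, injective y &
  forall i, (i < p.+1)%N -> gll_node R p i = y i.
Proof. by apply: injective_extension => i j ip jp; exact: gll_node_inj p_gt0 ip jp. Qed.

Lemma gll_lagrange_node (i j : 'I_p.+1) : (L i).[gll_node R p j] = (i == j)%:R.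
Proof.
have [y y_inj xy] := injective_nodes.
by rewrite /gll_lagrange (eq_lagrange xy) xy// lagrange_sample.
Qed.

(** The interpolant of the constant 1 is itself. *)
Lemma sum_gll_lagrange : \sum_i L i = 1.
Proof.
have [y y_inj xy] := injective_nodes.
rewrite [RHS](@lagrange_gen _ _ _ (ltn0Sn p) y_inj)//; last first.
  by rewrite size_poly1.
apply: eq_bigr => i _.
by rewrite /gll_lagrange (eq_lagrange xy) hornerE mul1r.
Qed.

End GLLLagrange.

(** The points 1/2, 1/3, 1/4, and so on provide as many roots as desired. *)
Lemma poly_eq0_itv (R : realFieldType) (f : {poly R}) :
  (forall x, -1 < x < 1 -> f.[x] = 0) -> f = 0.
Proof.
move=> f0; pose s := [seq i.+2%:R^-1 : R | i <- iota 0 (size f)].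
apply: (@roots_geq_poly_eq0 _ f s); last by rewrite size_map size_iota.
  apply/allP => _ /mapP[i _ ->]; apply/rootP/f0; apply/andP; split.
    by rewrite (lt_trans (ltrN10 _))// invr_gt0 ltr0n.
  by rewrite invf_lt1 ?ltr0n// ltr1n.
by rewrite map_inj_uniq ?iota_uniq// => i j /invr_inj/eqP; rewrite eqr_nat => /eqP[].
Qed.

(** Vanishing extends from the open square to the plane one variable at a time;
    evaluating at the nodes then isolates the coefficients.  The hypothesis is
    limited to the open square because that is where continuity turns vanishing
    almost everywhere into vanishing. *)
Lemma gll_lagrange_tensor_free (R : realType) (p : nat) (C : 'M[R]_p.+1) :
    (0 < p)%N ->
    (forall s t, -1 < s < 1 -> -1 < t < 1 ->
      \sum_i \sum_j C i j * ((gll_lagrange R i).[s] * (gll_lagrange R j).[t]) = 0) ->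
  C = 0.
Proof.
move=> p_gt0 C0.
have C1 s t : -1 < t < 1 ->
    \sum_i \sum_j C i j * ((gll_lagrange R i).[s] * (gll_lagrange R j).[t]) = 0.
  move=> tE.
  pose f := \sum_i (\sum_j C i j * (gll_lagrange R j).[t]) *: gll_lagrange R i.
  have fE x : f.[x] =
      \sum_i \sum_j C i j * ((gll_lagrange R i).[x] * (gll_lagrange R j).[t]).
    rewrite horner_sum; apply: eq_bigr => i _; rewrite hornerZ mulr_suml.
    by apply: eq_bigr => j _; rewrite mulrAC mulrA.
  by rewrite -fE [f]poly_eq0_itv ?horner0// => x xE; rewrite fE C0.
have C2 s t :
    \sum_i \sum_j C i j * ((gll_lagrange R i).[s] * (gll_lagrange R j).[t]) = 0.
  pose f := \sum_j (\sum_i C i j * (gll_lagrange R i).[s]) *: gll_lagrange R j.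
  have fE x : f.[x] =
      \sum_i \sum_j C i j * ((gll_lagrange R i).[s] * (gll_lagrange R j).[x]).
    rewrite horner_sum exchange_big; apply: eq_bigr => i _; rewrite hornerZ mulr_suml.
    by apply: eq_bigr => j _; rewrite mulrA.
  by rewrite -fE [f]poly_eq0_itv ?horner0// => x xE; rewrite fE C1.
apply/matrixP => i j; rewrite mxE -[RHS](C2 (gll_node R p i) (gll_node R p j)).
rewrite (bigD1 i)//= (bigD1 j)//= !gll_lagrange_node// !eqxx !mulr1.
rewrite big1 => [|k /negPf kj]; last by rewrite !gll_lagrange_node// kj !mulr0.
rewrite big1 ?addr0// => k /negPf ki; rewrite big1// => l _.
by rewrite !gll_lagrange_node// ki mul0r mulr0.
Qed.

(** * Gram matrices of integrals *)

Lemma integrable_sum_EFin d (T : measurableType d) (R : realType)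
    (mu : {measure set T -> \bar R}) (D : set T) (I : Type) (s : seq I)
    (f : I -> T -> R) : measurable D ->
  (forall i, mu.-integrable D (EFin \o f i)) ->
  mu.-integrable D (EFin \o (fun x => \sum_(i <- s) f i x)).
Proof.
move=> mD fi.
rewrite (_ : _ \o _ = fun x => (\sum_(i <- s) (EFin \o f i) x)%E).
  exact: integrable_sum.
by apply/funext => x /=; rewrite sumEFin.
Qed.

Lemma Rintegral_sum d (T : measurableType d) (R : realType)
    (mu : {measure set T -> \bar R}) (D : set T) (I : Type) (s : seq I)
    (f : I -> T -> R) : measurable D ->
  (forall i, mu.-integrable D (EFin \o f i)) ->
  \int[mu]_(x in D) (\sum_(i <- s) f i x) =
  \sum_(i <- s) \int[mu]_(x in D) f i x.
Proof.
move=> mD fi; elim: s => [|i s IHs].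
  by under eq_Rintegral do rewrite big_nil; rewrite big_nil Rintegral_cst// mul0r.
under eq_Rintegral do rewrite big_cons.
by rewrite big_cons -IHs RintegralD//; exact: integrable_sum_EFin.
Qed.

Lemma quadratic_form_sum (R : comPzRingType) n (M : 'M[R]_n) (c : 'cV[R]_n) :
  (c^T *m M *m c) 0 0 = \sum_i \sum_j c i 0 * c j 0 * M i j.
Proof.
rewrite -mulmxA mxE; apply: eq_bigr => i _; rewrite !mxE big_distrr/=.
by apply: eq_bigr => j _; rewrite mulrA mulrAC.
Qed.

Section Gram.
Context d (T : measurableType d) (R : realType) (mu : {measure set T -> \bar R}).
Variables (D : set T) (n : nat) (f : 'I_n -> T -> R) (c : 'cV[R]_n).
Hypothesis mD : measurable D.
Hypothesis fi : forall i j, mu.-integrable D (EFin \o (fun x => f i x * f j x)).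

Let sqr_sumE x : (\sum_i c i 0 * f i x) ^+ 2 =
  \sum_i \sum_j c i 0 * c j 0 * (f i x * f j x).
Proof.
rewrite expr2 big_distrlr/=.
by apply: eq_bigr => i _; apply: eq_bigr => j _; rewrite mulrACA.
Qed.

Let cfi (i j : 'I_n) : mu.-integrable D
  (EFin \o (fun x => c i 0 * c j 0 * (f i x * f j x))).
Proof.
have := integrableZl mD (c i 0 * c j 0) (fi i j).
by apply: eq_integrable => // x _; rewrite /= EFinM.
Qed.

Lemma integrable_sqr_sum :
  mu.-integrable D (EFin \o (fun x => (\sum_i c i 0 * f i x) ^+ 2)).
Proof.
under eq_fun do rewrite sqr_sumE.
by do 2 (apply: integrable_sum_EFin => // ?).
Qed.

Lemma gram_quadratic_form :
  (c^T *m (\matrix_(i, j) \int[mu]_(x in D) (f i x * f j x)) *m c) 0 0 =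
  \int[mu]_(x in D) (\sum_i c i 0 * f i x) ^+ 2.
Proof.
rewrite quadratic_form_sum; under [RHS]eq_Rintegral do rewrite sqr_sumE.
rewrite Rintegral_sum//; last by move=> i; exact: integrable_sum_EFin.
apply: eq_bigr => i _; rewrite Rintegral_sum//.
by apply: eq_bigr => j _; rewrite mxE -RintegralZl.
Qed.

End Gram.

Lemma Rintegral_sqr_eq0 d (T : measurableType d) (R : realType)
    (mu : {measure set T -> \bar R}) (D : set T) (g : T -> R) :
    measurable D -> measurable_fun D g ->
    mu.-integrable D (EFin \o (fun x => g x ^+ 2)) ->
    \int[mu]_(x in D) g x ^+ 2 = 0 ->
  mu.-negligible (D `&` [set x | g x != 0]).
Proof.
move=> mD mg ig intg0.
have : (\int[mu]_(x in D) `|((g x ^+ 2)%R)%:E|)%E = 0%E.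
  under eq_integral do rewrite /= ger0_norm ?sqr_ge0//.
  have := integrable_fin_num mD ig => /fineK <-.
  by rewrite -/(Rintegral mu D (fun x => g x ^+ 2)) intg0.
move/(ae_eq_integral_abs _ mD); case.
  by apply/measurable_EFinP; exact: measurable_funX.
move=> N [mN N0 sub]; exists N; split => // x [Dx /= gx]; apply: sub => /= /(_ Dx).
by move=> /eqP; rewrite eqe sqrf_eq0 (negPf gx).
Qed.

(** * Lebesgue measure on the plane *)

Lemma lebesgue_measure2_ball (R : realType) (a b r : R) : 0 <= r ->
  ((@lebesgue_measure R) \x (@lebesgue_measure R))%E (ball a r `*` ball b r) =
  (r *+ 2 * (r *+ 2))%:E.
Proof.
move=> r0; have mB (z : R) : measurable (ball z r) by exact: measurable_ball.
have mb z : @lebesgue_measure R (ball z r) = (r *+ 2)%:E.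
  exact: lebesgue_measure_ball r0.
refine (eq_trans (@product_measure1E _ _ _ _ _ (@lebesgue_measure R)
  (@lebesgue_measure R) _ _ (mB a) (mB b)) _).
refine (f_equal2 (fun x y => (x * y)%E) (mb _) (mb _)).
Qed.

(** A neighbourhood contains a square with positive side. *)
Lemma nbhs_not_negligible (R : realType) (x : R * R) (U : set (R * R)) :
    nbhs x U ->
  ~ ((@lebesgue_measure R) \x (@lebesgue_measure R))%E.-negligible U.
Proof.
move=> /nbhs_ballP[e /= e0 eU] [N [mN N0 UN]].
have eN : ball x.1 e `*` ball x.2 e `<=` N.
  by move=> y ey; apply/UN/eU.
have mB (z : R) : measurable (ball z e) by exact: measurable_ball.
have := @le_measure _ _ _ ((@lebesgue_measure R) \x (@lebesgue_measure R))%E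
  (ball x.1 e `*` ball x.2 e) N.
rewrite !inE => /(_ (measurableX (mB _) (mB _)) mN eN).
rewrite [X in (_ <= X)%E]N0 [X in (X <= _)%E](lebesgue_measure2_ball _ _ (ltW e0)).
by rewrite lee_fin leNgt mulr_gt0// pmulrn_lgt0.
Qed.

(** * The mass matrix of an element *)

Lemma mul_ptM (R : realType) (A B : 'M[R]_2) (x : R * R) :
  mul_pt A (mul_pt B x) = mul_pt (A *m B) x.
Proof.
by congr (_, _); rewrite /mul_pt/= !mxE !big_ord_recl !big_ord0 !addr0/=
  (_ : lift ord0 ord0 = 1); try (by apply/val_inj); ring.
Qed.

Lemma mul_pt1 (R : realType) (x : R * R) : mul_pt 1%:M x = x.
Proof.
by case: x => s t; congr (_, _); rewrite /= !mxE/= ?mul1r ?mul0r ?addr0 ?add0r.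
Qed.

Lemma elt_mapK (R : realType) (E : element R) : cancel (elt_map E) (elt_invmap E).
Proof.
move=> x; rewrite /elt_invmap /elt_map addrAC subrr add0r mul_ptM.
by rewrite mulVmx ?elt_lin_unit// mul_pt1.
Qed.

Lemma elt_invmapK (R : realType) (E : element R) : cancel (elt_invmap E) (elt_map E).
Proof.
move=> x; rewrite /elt_invmap /elt_map mul_ptM mulmxV ?elt_lin_unit//.
by rewrite mul_pt1 addrC subrK.
Qed.

(** As a preimage, the element is measurable as soon as the inverse map is. *)
Lemma elt_setE (R : realType) (E : element R) :
  elt_set E = elt_invmap E @^-1` ref_square.
Proof.
apply/seteqP; split=> [_ [xi xiS <-]|x xS]; first by rewrite /= elt_mapK.
by exists (elt_invmap E x); rewrite ?elt_invmapK.
Qed.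

Section ElementMeasure.
Context {R : realType}.
Local Notation mu2 := ((@lebesgue_measure R) \x (@lebesgue_measure R))%E.

Lemma continuous_elt_invmap (E : element R) : continuous (elt_invmap E).
Proof.
move=> [x1 x2]; rewrite /elt_invmap /mul_pt/=; set x : R * R := (x1, x2).
have cfst : (z.1 - (elt_orig E).1 : R^o) @[z --> x] --> (x1 - (elt_orig E).1 : R^o).
  by apply: cvgB; [exact: cvg_fst|exact: cvg_cst].
have csnd : (z.2 - (elt_orig E).2 : R^o) @[z --> x] --> (x2 - (elt_orig E).2 : R^o).
  by apply: cvgB; [exact: cvg_snd|exact: cvg_cst].
have caffine (a b : R) : (a * (z.1 - (elt_orig E).1) + b * (z.2 - (elt_orig E).2) : R^o)
    @[z --> x] --> (a * (x1 - (elt_orig E).1) + b * (x2 - (elt_orig E).2) : R^o).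
  by apply: cvgD; apply: cvgM => //; exact: cvg_cst.
exact: cvg_pair (caffine _ _) (caffine _ _).
Qed.

Lemma continuous_nodal_basis p (E : element R) k :
  continuous (fun x => nodal_basis p E x k 0).
Proof.
move=> x; case/mxvec_indexP: k => i j.
under eq_fun do rewrite mxE mxvecE mxE.
apply: cvgM.
  apply: (@continuous_comp _ _ _ (fun x => (elt_invmap E x).1)
    (horner (gll_lagrange R i))); last exact: continuous_horner.
  by apply: (@continuous_comp _ _ _ (elt_invmap E) fst);
    [exact: continuous_elt_invmap|exact: cvg_fst].
apply: (@continuous_comp _ _ _ (fun x => (elt_invmap E x).2)
  (horner (gll_lagrange R j))); last exact: continuous_horner.
by apply: (@continuous_comp _ _ _ (elt_invmap E) snd);
  [exact: continuous_elt_invmap|exact: cvg_snd].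
Qed.

Lemma measurable_elt_invmap (E : element R) :
  measurable_fun [set: measurableTypeR R * measurableTypeR R]
   (elt_invmap E : _ -> measurableTypeR R * measurableTypeR R).
Proof.
have m1 : measurable_fun [set: measurableTypeR R * measurableTypeR R]
    (fun x => x.1 - (elt_orig E).1 : measurableTypeR R).
  by apply: measurable_funB; [exact: measurable_fst|exact: measurable_cst].
have m2 : measurable_fun [set: measurableTypeR R * measurableTypeR R]
    (fun x => x.2 - (elt_orig E).2 : measurableTypeR R).
  by apply: measurable_funB; [exact: measurable_snd|exact: measurable_cst].
by apply/measurable_fun_pairP; split; apply: measurable_funD;
  apply: measurable_funM => //; exact: measurable_cst.
Qed.

Lemma measurable_elt_set (E : element R) :
  measurable (elt_set E : set (measurableTypeR R * measurableTypeR R)).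
Proof.
rewrite elt_setE -[X in measurable X]setTI.
apply: measurable_elt_invmap => //.
by apply: measurableX; exact: measurable_itv.
Qed.

Lemma measurable_nodal_basis p (E : element R) k :
  measurable_fun [set: measurableTypeR R * measurableTypeR R]
    (fun x => nodal_basis p E x k 0).
Proof.
case/mxvec_indexP: k => i j.
under eq_fun do rewrite mxE mxvecE mxE.
have /measurable_fun_pairP[m1 m2] := measurable_elt_invmap E.
apply: measurable_funM.
  by apply: (measurableT_comp _ m1); apply: continuous_measurable_fun;
    exact: continuous_horner.
by apply: (measurableT_comp _ m2); apply: continuous_measurable_fun;
    exact: continuous_horner.
Qed.

(** The image of the square under the affine map lies in a square around the
    image of its centre, with a side controlled by the entries of the linear part. *)
Lemma elt_set_finite_measure (E : element R) : (mu2 (elt_set E) < +oo)%E.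
Proof.
pose A := elt_lin E.
pose r := 1 + `|A 0 0| + `|A 0 1| + `|A 1 0| + `|A 1 1|.
have r0 : 0 <= r by rewrite /r !addr_ge0.
have sub : elt_set E `<=` ball (elt_orig E).1 r `*` ball (elt_orig E).2 r.
  move=> _ [[s t] /= [/= s1 t1] <-]; move: s1 t1; rewrite !in_itv/= -!ler_norml => s1 t1.
  have bnd a b : `|a * s + b * t| <= `|a| + `|b|.
    by rewrite (le_trans (ler_normD _ _))// !normrM lerD// ler_piMr.
  have A_ge0 i j : 0 <= `|A i j| by [].
  have := (A_ge0 0 0, A_ge0 0 1, A_ge0 1 0, A_ge0 1 1).
  by move=> [[[? ?] ?] ?]; split; rewrite /ball/= opprD addNKr normrN
    (le_lt_trans (bnd _ _))// -/A /r; lra.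
have mB (z : R) : measurable (ball z r) by exact: measurable_ball.
have := @le_measure _ _ _ mu2 (elt_set E)
  (ball (elt_orig E).1 r `*` ball (elt_orig E).2 r).
rewrite !inE => /(_ (measurable_elt_set E) (measurableX (mB _) (mB _)) sub).
move=> /le_lt_trans; apply.
by rewrite [X in (X < _)%E](lebesgue_measure2_ball _ _ r0) ltry.
Qed.

Lemma bounded_nodal_basis p (E : element R) k :
  exists B, forall x, elt_set E x -> `|nodal_basis p E x k 0| <= B.
Proof.
case/mxvec_indexP: k => i j.
have [B1 B1P] := poly_itv_bound (gll_lagrange R i) (-1) 1.
have [B2 B2P] := poly_itv_bound (gll_lagrange R j) (-1) 1.
exists (B1 * B2) => x; rewrite elt_setE => -[/=]; rewrite !in_itv/= => x1 x2.
by rewrite mxE mxvecE mxE normrM ler_pM// ?B1P ?B2P.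
Qed.

Lemma integrable_nodal_basisM p (E : element R) k l :
  mu2.-integrable (elt_set E)
    (EFin \o (fun x => nodal_basis p E x k 0 * nodal_basis p E x l 0)).
Proof.
apply: measurable_bounded_integrable.
- exact: measurable_elt_set.
- exact: elt_set_finite_measure.
- by apply: measurable_funM; apply: measurable_funTS; exact: measurable_nodal_basis.
- have [B1 B1P] := bounded_nodal_basis E k; have [B2 B2P] := bounded_nodal_basis E l.
  exists (B1 * B2); split; first exact: num_real.
  move=> M /ltW BM x Ex; apply: le_trans BM.
  by rewrite normrM ler_pM// ?B1P ?B2P.
Qed.

Lemma dotvE n (a b : 'cV[R]_n) : dotv a b = \sum_i a i 0 * b i 0.
Proof. by rewrite /dotv mxE; apply: eq_bigr => i _; rewrite mxE. Qed.

Lemma mass_matrix_quadratic_form p (E : element R) (c : 'cV[R]_(p.+1 * p.+1)) :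
  (c^T *m mass_matrix p E *m c) 0 0 =
  \int[mu2]_(x in elt_set E) (dotv c (nodal_basis p E x)) ^+ 2.
Proof.
rewrite gram_quadratic_form; last exact: integrable_nodal_basisM.
  by apply: eq_Rintegral => x _; rewrite dotvE.
exact: measurable_elt_set.
Qed.

Lemma dotv_nodal_basis p (E : element R) (c : 'cV[R]_(p.+1 * p.+1)) x :
  dotv c (nodal_basis p E x) = \sum_i \sum_j vec_mx c^T i j *
    ((gll_lagrange R i).[(elt_invmap E x).1] *
     (gll_lagrange R j).[(elt_invmap E x).2]).
Proof.
rewrite dotvE (reindex _ (curry_mxvec_bij _ _)) pair_big/=.
by apply: eq_bigr => -[i j] _ /=; rewrite !mxE mxvecE mxE.
Qed.

(** The entries add up to (sum_i L_i(s)) (sum_j L_j(t)) = 1; the point may lie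
    outside the element. *)
Lemma nodal_basis_neq0 p (E : element R) x : (0 < p)%N -> nodal_basis p E x != 0.
Proof.
move=> p_gt0; apply/eqP => b0.
have := @dotv_nodal_basis p E (const_mx 1) x; rewrite b0 dotvE big1; last first.
  by move=> k _; rewrite !mxE mulr0.
under eq_bigr => i _ do under eq_bigr => j _ do rewrite !mxE mul1r.
rewrite -big_distrlr/= -!horner_sum !sum_gll_lagrange// !hornerE.
by move/eqP; rewrite eq_sym oner_eq0.
Qed.

(** The interior of the element contains the image of the open reference
    square. *)
Lemma nodal_basis_free p (E : element R) (c : 'cV[R]_(p.+1 * p.+1)) : (0 < p)%N ->
    (forall x, interior (elt_set E) x -> dotv c (nodal_basis p E x) = 0) ->
  c = 0.
Proof.
move=> p_gt0 c0.
rewrite -[c]trmxK -[c^T]vec_mxK (_ : vec_mx _ = 0) ?linear0 ?trmx0//.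
apply: gll_lagrange_tensor_free => // s t sI tI.
rewrite -[RHS](c0 (elt_map E (s, t))) ?dotv_nodal_basis ?elt_mapK//.
rewrite elt_setE; apply: continuous_elt_invmap; rewrite elt_mapK.
have itv_nbhs (z : R) : -1 < z < 1 -> nbhs z `[-1, 1]%classic.
  move=> zI; have : z \in `]-1, 1[ by rewrite in_itv.
  by move=> /near_in_itvoo; apply: filterS => y /subset_itv_oo_cc.
by exists (`[-1, 1]%classic, `[-1, 1]%classic) => [|y]; [split; exact: itv_nbhs|].
Qed.

(** If the quadratic form vanishes at c, the function that c represents is zero
    off a negligible set; at an interior point where it did not vanish it would,
    by continuity, be nonzero on a whole neighbourhood. *)
Lemma mass_matrix_positive_definite p (E : element R) : (0 < p)%N ->
  positive_definite (mass_matrix p E).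
Proof.
move=> p_gt0 c; apply: contraNT; rewrite -leNgt mass_matrix_quadratic_form => le0.
pose g x := dotv c (nodal_basis p E x).
have mg : measurable_fun (elt_set E : set (measurableTypeR R * measurableTypeR R)) g.
  apply: measurable_funTS; rewrite /g; under eq_fun do rewrite dotvE.
  by apply: measurable_sum => k; apply: measurable_funM;
    [exact: measurable_cst|exact: measurable_nodal_basis].
have cg : continuous g.
  rewrite /g; under eq_fun do rewrite dotvE.
  apply: continuous_big => [|k _ x]; first exact: add_continuous.
  by apply: cvgM; [exact: cvg_cst|exact: continuous_nodal_basis].
have ig : mu2.-integrable (elt_set E) (EFin \o (fun x => g x ^+ 2)).
  rewrite /g; under eq_fun do rewrite dotvE.
  apply: integrable_sqr_sum; [exact: measurable_elt_set|].
  by move=> k l; exact: integrable_nodal_basisM.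
have [N [mN N0 subN]] : mu2.-negligible (elt_set E `&` [set x | g x != 0]).
  apply: Rintegral_sqr_eq0 => //; first exact: measurable_elt_set.
  by apply/eqP; rewrite eq_le le0 Rintegral_ge0// => x _; rewrite sqr_ge0.
apply/eqP/(@nodal_basis_free p E) => // x Ex; apply/eqP/negPn/negP => gx0.
have : nbhs x (elt_set E `&` [set x | g x != 0]).
  apply: filterI => //.
  have := cvgr_neq0 _ (cg x) gx0.
  exact.
by move=> /nbhs_not_negligible; apply; exists N.
Qed.

End ElementMeasure.

(** * The modified boundary value *)

Theorem proposition2 (R : realType) (p : nat) (hp : (1 <= p)%N)
    (mesh : set (element R)) (hmesh : is_mesh mesh)
    (Omega : set (R * R)) (to_bnd : R * R -> R * R)
    (hto_bnd : forall x, surrogate_boundary mesh x ->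
       topo_boundary Omega (to_bnd x))
    (E : element R) (hE : mesh E)
    (xt xb : R * R) (hxtE : elt_set E xt) (hxt : surrogate_boundary mesh xt)
    (hxb : xb = to_bnd xt)
    (u : 'cV[R]_(p.+1 * p.+1)) (uD : R) :
  rod_matrix p E xb \in unitmx /\
  forall (v : 'cV[R]_(p.+1 * p.+1)) (lam utD : R),
    rod_matrix p E xb *m col_mx v lam%:M = rod_rhs E u uD ->
    utD = dotv (nodal_basis p E xt) v ->
    utD =
      dotv (nodal_basis p E xt - rod_alpha p E xt xb *: nodal_basis p E xb) u
      + rod_alpha p E xt xb * uD.
Proof.
have M_pd := mass_matrix_positive_definite E hp.
have b0 := nodal_basis_neq0 E xb hp.
split; first exact: saddle_point_unit.
move=> v lam utD sol ->; apply: saddle_point_dotv sol.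
  exact: positive_definite_unit.
by rewrite gt_eqF// sqnorm_inv_gt0.
Qed.
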